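(* Let $\varphi:\mathfrak{h}\to V^*$ be a real factorization structure and $\varphi^{\mathbb{C}}:\mathfrak{h}\otimes\mathbb{C}\to V^*\otimes\mathbb{C}$ its complexification (a complex factorization structure). For each $j$, the factorization curve $\psi_j$ of $\varphi$ is decomposable if and only if the $j$-th factorization curve $\psi_j^{\mathbb{C}}$ of $\varphi^{\mathbb{C}}$ is decomposable. Moreover, a real decomposable curve $\psi_j$ admits the real analogue of the characterisation of decomposable curves: there exist $S\subset\{1,\ldots,m\}$ with $|S|=\deg\psi_j$, a real 1-dimensional subspace $\Gamma_j\subset\bigotimes_{r\notin S}V_r^*$ and real invertible projective transformations $g_r:\mathbb{P}(V_j^* )\to\mathbb{P}(V_r^* )$, $r\in S$, such that for all $\ell\in\mathbb{P}(V_j)$ the line $\varphi(\psi_j(\ell))$ is spanned by the tensor with $g_r\ell^0$ in slot $r$ for $r\in S$ and $\Gamma_j$ in the other slots.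
   Context: $V_1,\ldots,V_m$ are 2-dimensional real vector spaces, $V^*=V_1^*\otimes\cdots\otimes V_m^*$; for a complex version all spaces are tensored with $\mathbb{C}$ and $V^*\otimes\mathbb{C}=\bigotimes_j(V_j^*\otimes\mathbb{C})$. $\ell^0$ denotes the annihilator of a line $\ell$. ''Generic'' means on a nonempty Zariski-open subset of a projective space. $\Sigma^0_{j,\ell}=V_1^*\otimes\cdots\otimes\ell^0\otimes\cdots\otimes V_m^*$. A (real or complex) factorization structure of dimension $m$ is an injective linear map $\varphi:\mathfrak{h}\to V^*$, $\dim\mathfrak{h}=m+1$, with $\dim(\varphi(\mathfrak{h})\cap\Sigma^0_{j,\ell})=1$ for all $j$ and generic $\ell\in\mathbb{P}(V_j)$. The $j$-th factorization curve $\psi_j:\mathbb{P}(V_j)\to\mathbb{P}(\mathfrak{h})$ is the unique regular extension of the generically defined regular map $\ell\mapsto\varphi^{-1}(\varphi(\mathfrak{h})\cap\Sigma^0_{j,\ell})$; $\deg\psi_j$ is the integer $e$ with $\psi_j^*\mathcal{O}_{\mathfrak{h}}(1)\cong\mathcal{O}_{V_j}(e)$. Curves with the same image are equivalent; $\psi_j$ is decomposable if its equivalence class in $\{\psi_1,\ldots,\psi_m\}$ has exactly $\deg\psi_j$ elements. *)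

(* Defs.v *)
From HB Require Import structures.
From mathcomp Require Import all_boot all_order all_algebra.
From mathcomp Require Import reals.
From mathcomp Require Export complex.
Set Implicit Arguments. Unset Strict Implicit. Unset Printing Implicit Defensive.
Import Order.TTheory GRing.Theory Num.Theory.
Local Open Scope ring_scope.

(* V_j = K^2 (row vectors 'rV_2), V_j^* = K^2 (covectors, row vectors,
   pairing alpha(v) = alpha *m v^T).  V^* = V_1^* (x) ... (x) V_m^* has the
   basis indexed by multi-indices idx m = {ffun 'I_m -> 'I_2}; a tensor is a
   row vector of size tdim m = #|idx m| = 2^m, coordinate k <-> enum_val k. *)
Definition idx (m : nat) := {ffun 'I_m -> 'I_2}.
Definition tdim (m : nat) := #|{: idx m}|.
Definition ival (m : nat) (k : 'I_(tdim m)) : idx m := enum_val k.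

(* subspaces are represented by matrices (row spaces).  The tensor product
   U_1 (x) ... (x) U_m of subspaces U_r <= V_r^* is spanned by the tensor
   products of rows of the U_r. *)
Definition tensor_mx (K : fieldType) (m : nat) (U : 'I_m -> 'M[K]_2)
  : 'M[K]_(tdim m, tdim m) :=
  \matrix_(s, i) \prod_(r < m) U r (ival s r) (ival i r).

(* (x)_{r in S} U_r  (x)  Gamma, where Gamma = span(gamma) <= (x)_{r notin S} V_r^*,
   gamma being encoded as a function of multi-indices not depending on the
   coordinates in S (see gamma_in). *)
Definition tensor_span (K : fieldType) (m : nat) (S : {set 'I_m})
  (U : 'I_m -> 'M[K]_2) (gamma : idx m -> K) : 'M[K]_(tdim m, tdim m) :=
  \matrix_(s, i) ((\prod_(r in S) U r (ival s r) (ival i r)) * gamma (ival i)).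

(* gamma is a nonzero element of (x)_{r notin S} V_r^* *)
Definition gamma_in (K : fieldType) (m : nat) (S : {set 'I_m}) (gamma : idx m -> K) :=
  (exists i, gamma i != 0) /\
  (forall i i' : idx m, (forall r, r \notin S -> i r = i' r) -> gamma i = gamma i').

Definition ann (K : fieldType) (l : 'rV[K]_2) : 'M[K]_2 := kermx l^T.

Definition Sigma0 (K : fieldType) (m : nat) (j : 'I_m) (l : 'rV[K]_2)
  : 'M[K]_(tdim m, tdim m) :=
  tensor_mx (fun r => if r == j then ann l else 1%:M).

(* P holds for generic l in P(V_j) = P^1: on a nonempty Zariski-open subset,
   i.e. outside finitely many points of P^1 (K infinite). *)
Definition generic (K : fieldType) (P : 'rV[K]_2 -> Prop) :=
  exists s : seq 'rV[K]_2,
    forall l : 'rV[K]_2, l != 0 -> (forall x, x \in s -> ~~ (l == x)%MS) -> P l.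

(* factorization structure: phi : h = K^(m+1) -> V^*, v |-> v *m Phi *)
Definition facstr (K : fieldType) (m : nat) (Phi : 'M[K]_(m.+1, tdim m)) :=
  row_free Phi /\
  forall j : 'I_m, generic (fun l => \rank (Phi :&: Sigma0 j l)%MS = 1%N).

(* A regular map P^1 -> P(h) = P^m of degree e is given by m+1 binary forms
   f_i(x,y) = sum_{k<=e} (F i)_k x^k y^(e-k) of degree e without common
   nonconstant factor (y is not a common factor and the dehomogenised
   polynomials F i have trivial gcd). *)
Definition form_eval (K : fieldType) (m e : nat) (F : 'I_m.+1 -> {poly K})
  (l : 'rV[K]_2) : 'rV[K]_(m.+1) :=
  \row_i \sum_(k < e.+1) (F i)`_k * (l 0 0) ^+ k * (l 0 1) ^+ (e - k).

Definition regular_curve (K : fieldType) (m e : nat) (F : 'I_m.+1 -> {poly K}) :=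
  [/\ forall i, (size (F i) <= e.+1)%N,
      exists i, (F i)`_e != 0
    & size (foldr (@gcdp K) 0 [seq F i | i <- enum 'I_m.+1]) = 1%N].

(* (e, F) represents the j-th factorization curve psi_j of phi (of degree e):
   the regular map extending l |-> phi^-1(phi(h) :&: Sigma0_{j,l}). *)
Definition fcurve (K : fieldType) (m : nat) (Phi : 'M[K]_(m.+1, tdim m))
  (j : 'I_m) (e : nat) (F : 'I_m.+1 -> {poly K}) :=
  regular_curve e F /\
  generic (fun l => form_eval e F l != 0 /\
                    (form_eval e F l *m Phi == (Phi :&: Sigma0 j l))%MS).

Definition same_image (K : fieldType) (m e1 e2 : nat)
  (F1 F2 : 'I_m.+1 -> {poly K}) :=
  (forall l, l != 0 -> exists2 l', l' != 0 & (form_eval e1 F1 l == form_eval e2 F2 l')%MS) /\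
  (forall l, l != 0 -> exists2 l', l' != 0 & (form_eval e2 F2 l == form_eval e1 F1 l')%MS).

Definition decomposable (K : fieldType) (m : nat) (es : 'I_m -> nat)
  (Fs : 'I_m -> 'I_m.+1 -> {poly K}) (j : 'I_m) :=
  exists A : {set 'I_m},
    (forall i, i \in A <-> same_image (es i) (es j) (Fs i) (Fs j)) /\ #|A| = es j.

(* Main.v *)
Require Import Defs.
From HB Require Import structures.
From mathcomp Require Import all_boot all_order all_algebra.
From mathcomp Require Import reals complex.
From mathcomp Require Import boolp ring zify.
Import Order.TTheory GRing.Theory Num.Theory.
Local Open Scope ring_scope.

(** Write [T(l)] for the tensor [phi (psi_j l)], a form of degree [e] in [l].
    If [psi_q] has the same image as [psi_j], then [T(l)] has rank one in slot
    [q] for every real [l]; over the principal ideal domain [R[x]] a coprime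
    vector [a_q] splits off in that slot, and it is not constant because [psi_j]
    is injective. Splitting off all slots of the class [A] of [j] gives
    [T = (tensor of the a_q, q in A) * beta], and comparing degrees yields
    [#|A| <= e]; in case of equality every [a_q] is linear and [beta] constant,
    which is the announced description of a decomposable curve.

    The complex curves are the complexifications of the real ones up to scalars.
    Curves with the same complex image have the same real image: for real [l]
    the matching parameter is the kernel of a contraction of a real tensor.
    Conversely, in the decomposable case the linear [a_q] reparametrise [psi_j]
    into [psi_q], an identity of polynomials that persists over [C]. Together
    with [#|A| <= e] this compares the two classes. *)

(** * Vectors and covectors in dimension two *)

Lemma forall_I2 (P : 'I_2 -> Prop) : P 0 -> P 1 -> forall k, P k.
Proof.
move=> P0 P1 k; case: (unliftP 0 k) => [k'|] -> //.
by rewrite (ord1 k'); have -> : lift 0 0 = 1 :> 'I_2 by apply/val_inj.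
Qed.

Lemma sum_I2 (V : nmodType) (F : 'I_2 -> V) : \sum_k F k = F 0 + F 1.
Proof.
rewrite big_ord_recl big_ord1; congr (_ + F _); exact/val_inj.
Qed.

Lemma row2P {K : fieldType} (u v : 'rV[K]_2) :
  u 0 0 = v 0 0 -> u 0 1 = v 0 1 -> u = v.
Proof. by move=> h0 h1; apply/rowP; apply: forall_I2. Qed.

Definition row2 {K : fieldType} (x y : K) : 'rV[K]_2 :=
  \row_k (if k == 0 then x else y).

Lemma row2_0 {K : fieldType} (x y : K) : row2 x y 0 0 = x.
Proof. by rewrite mxE. Qed.
Lemma row2_1 {K : fieldType} (x y : K) : row2 x y 0 1 = y.
Proof. by rewrite mxE. Qed.
Definition row2E := (@row2_0, @row2_1).

Lemma row2_neq0 {K : fieldType} (l : 'rV[K]_2) :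
  (l != 0) = (l 0 0 != 0) || (l 0 1 != 0).
Proof.
rewrite -negb_and; congr (~~ _); apply/eqP/andP => [->|[/eqP h0 /eqP h1]].
  by rewrite !mxE.
by apply: row2P; rewrite !mxE.
Qed.

Lemma row2_map {K L : fieldType} (f : {rmorphism K -> L}) (x y : K) :
  map_mx f (row2 x y) = row2 (f x) (f y).
Proof. by apply: row2P; rewrite mxE !row2E. Qed.

(* The line of covectors annihilating [l] is spanned by [perp l]. *)
Definition perp {K : fieldType} (l : 'rV[K]_2) : 'rV[K]_2 :=
  row2 (l 0 1) (- l 0 0).

Lemma colinear2 {K : fieldType} (t l : 'rV[K]_2) :
  t != 0 -> l 0 0 * t 0 0 + l 0 1 * t 0 1 = 0 ->
  exists c, l = c *: perp t.
Proof.
rewrite row2_neq0 => t0 e; have [t10|t1] := eqVneq (t 0 1) 0.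
  rewrite t10 eqxx orbF in t0; exists (- l 0 1 / t 0 0).
  apply: row2P; rewrite !mxE /= ?t10; last by field.
  by move: e; rewrite t10 !mulr0 addr0 => /eqP; rewrite mulf_eq0 (negPf t0) orbF => /eqP.
exists (l 0 0 / t 0 1); apply: row2P; rewrite !mxE /=; first by field.
apply: (mulIf t1); rewrite mulrAC divfK // mulrN.
by apply/eqP; rewrite -addr_eq0 addrC e.
Qed.

(* Evaluation at [l] of the binary form of degree [e] whose dehomogenisation is [p]. *)
Definition heval {K : fieldType} (e : nat) (p : {poly K}) (l : 'rV[K]_2) : K :=
  \sum_(k < e.+1) p`_k * l 0 0 ^+ k * l 0 1 ^+ (e - k).

(** * Binary forms handled through their dehomogenisations *)

Section Heval.
Context {K : fieldType}.
Implicit Types (p q : {poly K}) (l : 'rV[K]_2).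

Lemma heval_affine e p l : (size p <= e.+1)%N -> l 0 1 != 0 ->
  heval e p l = l 0 1 ^+ e * p.[l 0 0 / l 0 1].
Proof.
move=> sp l1; rewrite (horner_coef_wide _ sp) mulr_sumr; apply: eq_bigr => k _.
have -> : l 0 1 ^+ e = l 0 1 ^+ (e - k) * l 0 1 ^+ k by rewrite -exprD subnK // -ltnS.
by rewrite expr_div_n; have := expf_neq0 k l1 => h; field.
Qed.

Lemma heval_x1 e p x : (size p <= e.+1)%N -> heval e p (row2 x 1) = p.[x].
Proof. by move=> sp; rewrite heval_affine ?row2E ?oner_eq0 // divr1 expr1n mul1r. Qed.

Lemma heval_infty e p l : l 0 1 = 0 -> heval e p l = p`_e * l 0 0 ^+ e.
Proof.
move=> l1; rewrite /heval big_ord_recr /= big1 ?add0r ?subnn ?expr0 ?mulr1 //.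
by move=> k _; rewrite l1 expr0n subn_eq0 leqNgt ltn_ord mulr0.
Qed.

(** The size bounds leave a single term of the convolution. They need not be sharp: [d] and [e] are
    nominal degrees, as needed for forms vanishing at infinity. *)
Lemma coefM_top d e p q : (size p <= d.+1)%N -> (size q <= e.+1)%N ->
  (p * q)`_(d + e) = p`_d * q`_e.
Proof.
move=> sp sq; have ld : (d < (d + e).+1)%N by rewrite ltnS leq_addr.
rewrite coefM (bigD1 (Ordinal ld)) //= addKn big1 ?addr0 // => k nk.
have [kd|kd] := ltnP k d.
  rewrite [q`__]nth_default ?mulr0 // (leq_trans sq) // ltn_subRL.
  by rewrite addnC [leqRHS]addnC ltn_add2l.
rewrite [p`__]nth_default ?mul0r // (leq_trans sp) // ltn_neqAle kd andbT.
by apply: contra nk => /eqP h; apply/eqP/val_inj.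
Qed.

Lemma hevalM d e p q l : (size p <= d.+1)%N -> (size q <= e.+1)%N ->
  heval (d + e) (p * q) l = heval d p l * heval e q l.
Proof.
move=> sp sq; have [l1|l1] := eqVneq (l 0 1) 0.
  by rewrite !heval_infty // coefM_top // exprD mulrACA.
rewrite !heval_affine // ?hornerM ?exprD 1?mulrACA //.
apply: leq_trans (size_polyMleq _ _) _.
by rewrite -subn1 leq_subLR (leq_trans (leq_add sp sq)) // addSn addnS.
Qed.

Lemma hevalD e p q l : heval e (p + q) l = heval e p l + heval e q l.
Proof. by rewrite -big_split; apply: eq_bigr => k _; rewrite coefD !mulrDl. Qed.

Lemma hevalZ e c p l : heval e (c *: p) l = c * heval e p l.
Proof. by rewrite mulr_sumr; apply: eq_bigr => k _; rewrite coefZ !mulrA. Qed.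

Lemma heval0 e l : heval e 0 l = 0.
Proof. by rewrite -[0 in LHS](scale0r 0) hevalZ mul0r. Qed.

Lemma heval_sum (I : finType) e (F : I -> {poly K}) l :
  heval e (\sum_i F i) l = \sum_i heval e (F i) l.
Proof. exact: (big_morph (fun p => heval e p l) (fun p q => hevalD e p q l) (heval0 e l)). Qed.

Lemma heval_scale e p c l : heval e p (c *: l) = c ^+ e * heval e p l.
Proof.
rewrite mulr_sumr; apply: eq_bigr => k _; rewrite !mxE !exprMn.
have -> : c ^+ e = c ^+ k * c ^+ (e - k) by rewrite -exprD subnKC // -ltnS.
by ring.
Qed.

Lemma heval_lin p l : heval 1 p l = p`_0 * l 0 1 + p`_1 * l 0 0.
Proof. by rewrite /heval big_ord_recl big_ord1 /=; ring. Qed.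

Lemma heval_const p l : heval 0 p l = p`_0.
Proof. by rewrite /heval big_ord1 !mulr1. Qed.

Lemma heval_map (L : fieldType) (f : {rmorphism K -> L}) e p l :
  heval e (map_poly f p) (map_mx f l) = f (heval e p l).
Proof.
by rewrite rmorph_sum; apply: eq_bigr => k _; rewrite coef_map !mxE !rmorphM !rmorphXn.
Qed.

(** The size bound is proved together with the evaluation because [hevalM] needs it at each step of
    the induction. *)
Lemma heval_prod (I : finType) (A : {set I}) (p : I -> {poly K}) l :
  (forall x, x \in A -> (size (p x) <= 2)%N) ->
  (size (\prod_(x in A) p x)%R <= #|A|.+1)%N /\
  heval #|A| (\prod_(x in A) p x) l = \prod_(x in A) heval 1 (p x) l.
Proof.
move=> sp; rewrite -!big_enum cardE.
have : all (fun x => size (p x) <= 2)%N (enum A).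
  by apply/allP => x; rewrite mem_enum => /sp.
elim: (enum A) => [_|x s IH /= /andP[sx /IH[ss hs]]].
  by rewrite !big_nil size_poly1 heval_const coef1.
rewrite !big_cons; split; last by rewrite -[(size s).+1]add1n hevalM // hs.
apply: leq_trans (size_polyMleq _ _) _.
by rewrite -subn1 leq_subLR (leq_trans (leq_add sx ss)).
Qed.

End Heval.

(** * Slots of a tensor and contractions *)

Section Updates.
Context {m : nat}.
Implicit Types (i : idx m) (q r : 'I_m) (k : 'I_2).

Definition upd i q k : idx m := [ffun r => if r == q then k else i r].

Lemma upd_same i q k : upd i q k q = k.
Proof. by rewrite ffunE eqxx. Qed.

Lemma upd_other i q k r : r != q -> upd i q k r = i r.
Proof. by move=> h; rewrite ffunE (negPf h). Qed.

Lemma upd_id i q : upd i q (i q) = i.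
Proof. by apply/ffunP => r; rewrite ffunE; case: eqP => // ->. Qed.

Lemma upd_upd i q k k' : upd (upd i q k) q k' = upd i q k'.
Proof. by apply/ffunP => r; rewrite !ffunE; case: eqP. Qed.

Lemma updC i q r k k' : q != r ->
  upd (upd i q k) r k' = upd (upd i r k') q k.
Proof.
move=> h; apply/ffunP => x; rewrite !ffunE.
by case: eqP => // ->; rewrite eq_sym (negPf h).
Qed.

End Updates.

Section Contraction.
Context {K : fieldType} {m : nat}.
Implicit Types (i : idx m) (q : 'I_m) (k : 'I_2) (T : idx m -> K) (l : 'rV[K]_2).

Definition tcoord (v : 'rV[K]_(tdim m)) i : K := v 0 (enum_rank i).

(** Vanishing of the contraction of slot [q] with [l]: the equations of the row space
    [Sigma0 q l]. *)
Definition contr T q l := forall i,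
  l 0 0 * T (upd i q 0) + l 0 1 * T (upd i q 1) = 0.

Definition slot T q i : 'rV[K]_2 := row2 (T (upd i q 0)) (T (upd i q 1)).

Lemma slot_neq0 T q i : T i != 0 -> slot T q i != 0.
Proof.
rewrite -{1}(upd_id i q) row2_neq0 !row2E.
by elim/forall_I2: (i q) => ->; rewrite ?orbT.
Qed.

Lemma contr_slot T q i l : T i != 0 -> contr T q l ->
  exists c, l = c *: perp (slot T q i).
Proof.
by move=> Ti Tl; apply: colinear2; [apply: slot_neq0 | rewrite !row2E].
Qed.

Lemma contr_uniq T q i l l' : T i != 0 -> contr T q l -> contr T q l' ->
  l != 0 -> exists c, l' = c *: l.
Proof.
move=> Ti /(contr_slot _ _ _ _ Ti)[a ->] /(contr_slot _ _ _ _ Ti)[b ->].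
rewrite scaler_eq0 negb_or => /andP[a0 _].
by exists (b / a); rewrite scalerA divfK.
Qed.

(** All slot vectors are annihilated by the same nonzero [l], so any two of them are dependent: [T]
    has rank at most one in slot [q]. *)
Lemma contr_minors T q l : contr T q l -> l != 0 ->
  forall i i', T (upd i q 0) * T (upd i' q 1) = T (upd i q 1) * T (upd i' q 0).
Proof.
move=> Tl l0 i i'; have := Tl i; have := Tl i'.
set a := T (upd i q 0); set b := T (upd i q 1).
set c := T (upd i' q 0); set d := T (upd i' q 1) => ecd eab.
move: l0; rewrite row2_neq0 => /orP[] /mulfI; apply.
  have -> : l 0 0 * (a * d) = (l 0 0 * a + l 0 1 * b) * d - l 0 1 * (b * d) by ring.
  have -> : l 0 0 * (b * c) = b * (l 0 0 * c + l 0 1 * d) - l 0 1 * (b * d) by ring.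
  by rewrite ecd eab mul0r mulr0.
have -> : l 0 1 * (a * d) = a * (l 0 0 * c + l 0 1 * d) - l 0 0 * (a * c) by ring.
have -> : l 0 1 * (b * c) = (l 0 0 * a + l 0 1 * b) * c - l 0 0 * (a * c) by ring.
by rewrite ecd eab mul0r mulr0.
Qed.

Lemma ann_mul l k : ann l k 0 * l 0 0 + ann l k 1 * l 0 1 = 0.
Proof.
have /matrixP/(_ k 0) : ann l *m l^T = 0 by apply: mulmx_ker.
by rewrite !mxE sum_I2 !mxE.
Qed.

(** [kermx] returns a square matrix of rank one whose rows are not canonical; only their
    proportionality to [perp l] can be used. *)
Lemma ann_perp l : l != 0 -> exists c : 'I_2 -> K,
  (exists k, c k != 0) /\ forall k k', ann l k k' = c k * perp l 0 k'.
Proof.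
move=> l0.
have /(_ _)/cid h k : exists c, row k (ann l) = c *: perp l.
  by apply: colinear2 => //; rewrite -[RHS](ann_mul l k) !mxE.
exists (fun k => sval (h k)).
have e k k' : ann l k k' = sval (h k) * perp l 0 k'.
  by case: (h k) => c /= /rowP/(_ k'); rewrite !mxE.
split=> //; have : ann l != 0.
  by rewrite -mxrank_eq0 mxrank_ker mxrank_tr rank_rV l0.
apply: contra_neqP => c0; apply/matrixP => k k'.
rewrite e; have [->|ck] := eqVneq (sval (h k)) 0; first by rewrite mul0r mxE.
by case: c0; exists k.
Qed.

Lemma Sigma0E j l s i : Sigma0 j l s (enum_rank i) =
  ann l (ival s j) (i j) *
    \prod_(r | r != j) (1%:M : 'M[K]_2) (ival s r) (i r).
Proof.
rewrite mxE /ival enum_rankK (bigD1 j) //= eqxx; congr (_ * _).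
by apply: eq_bigr => r /negPf ->.
Qed.

(** Each row of [ann l] kills [l], which gives one direction. Conversely every slot vector of [v]
    lies in the row space of [ann l], and its coefficients there assemble into a preimage of [v]. *)
Lemma Sigma0P j l (v : 'rV[K]_(tdim m)) :
  (v <= Sigma0 j l)%MS <-> contr (tcoord v) j l.
Proof.
split=> [/submxP[D ->] i|Tl].
  rewrite /tcoord !mxE !mulr_sumr -big_split big1 //= => s _.
  rewrite !Sigma0E !upd_same.
  rewrite [X in _ + _ * (_ * (_ * X))](eq_bigr (fun r => 1%:M (ival s r) (upd i j 0 r))).
    set P := \prod_(_ | _) _.
    suff e: ann l (ival s j) 0 * l 0 0 + ann l (ival s j) 1 * l 0 1 = 0.
      by rewrite -(mulr0 (D 0 s * P)) -e; ring.
    exact: ann_mul.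
  by move=> r rj; rewrite !upd_other.
pose c i := slot (tcoord v) j i *m pinvmx (ann l).
apply/submxP; exists (\row_s c (ival s) 0 (ival s j)).
apply/rowP => t; rewrite -(enum_valK t); move: (enum_val t) => i.
rewrite mxE (reindex (@enum_rank {: idx m})) /=; last first.
  exact/onW_bij/enum_rank_bij.
rewrite (partition_big (fun s : idx m => s j) predT) //=.
have -> : v 0 (enum_rank i) = (c i *m ann l) 0 (i j).
  rewrite /c mulmxKpV; last first.
    apply/sub_kermxP/rowP => x; rewrite !mxE sum_I2 !mxE /= ord1.
    by rewrite -(Tl i); ring.
  by rewrite -{1}(upd_id i j) /slot mxE; elim/forall_I2: (i j).
rewrite mxE; apply: eq_bigr => k _.
(* The identity factors outside slot [j] kill every row index that differs from [i] in another
   slot. *)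
rewrite (bigD1 (upd i j k)) /=; last by rewrite upd_same.
rewrite big1 ?addr0 => [|s /andP[/eqP sj si]].
  rewrite mxE Sigma0E /ival enum_rankK upd_same /c /slot !upd_upd.
  rewrite big1 ?mulr1 // => r rj; by rewrite upd_other // mxE eqxx.
rewrite Sigma0E /ival enum_rankK.
have [r rj sr] : exists2 r, r != j & s r != i r.
  apply: contra_neqP si => h; apply/ffunP => r; rewrite ffunE.
  case: eqP => [->//|/eqP rj]; apply/eqP/negPn/negP => sr.
  by apply: h; exists r.
by rewrite [\prod_(_ | _) _](bigD1 r) //= [1%:M _ _]mxE (negPf sr) !(mul0r, mulr0).
Qed.

End Contraction.

(** * Curves as tuples of binary forms *)

Lemma eq_rowsP {K : fieldType} {n : nat} (u v : 'rV[K]_n) :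
  (u == v)%MS <-> exists2 a, a != 0 & u = a *: v.
Proof.
split=> [/andP[/sub_rVP[a e] vu]|[a a0 ->]]; last first.
  exact/eqmxP/eqmx_scale.
have [a0|a0] := eqVneq a 0; last by exists a.
exists 1; first exact: oner_neq0.
by case/sub_rVP: vu => b ->; rewrite e a0 scale0r !scaler0.
Qed.

Lemma eq_rows_minors {K : fieldType} {n : nat} (u v : 'rV[K]_n) :
  u != 0 -> v != 0 -> (forall p q, u 0 p * v 0 q = u 0 q * v 0 p) ->
  (u == v)%MS.
Proof.
move=> u0 v0 uv; apply/eq_rowsP.
have [q vq] : exists q, v 0 q != 0.
  by apply/existsP; apply: contra_neqT v0 => /existsPn h; apply/rowP => q;
     rewrite mxE; apply/eqP/negPn/h.
have e : u = (u 0 q / v 0 q) *: v.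
  by apply/rowP => p; rewrite mxE; apply: (mulIf vq); rewrite uv; field.
exists (u 0 q / v 0 q) => //.
by apply: contra_neq u0 => h; rewrite e h scale0r.
Qed.

(** Multiplying by a polynomial that vanishes on [s] gives a product vanishing everywhere, in
    particular at more naturals than its degree allows; these are distinct in characteristic
    zero. *)
Lemma poly_eq0_cofinite {K : numFieldType} (p : {poly K}) (s : seq K) :
  (forall x, x \notin s -> p.[x] = 0) -> p = 0.
Proof.
move=> ps; pose w := \prod_(y <- s) ('X - y%:P).
have w0 : w != 0 by apply/monic_neq0/monic_prod_XsubC.
apply/eqP; apply/negPn/negP => p0; have pw : p * w != 0 by rewrite mulf_neq0.
pose xs := [seq n%:R : K | n <- iota 0 (size (p * w))].
suff : (size xs < size (p * w)%R)%N by rewrite size_map size_iota ltnn.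
apply: max_poly_roots => //; last first.
  by rewrite map_inj_uniq ?iota_uniq // => a b /eqP; rewrite eqr_nat => /eqP.
apply/allP => x _; rewrite rootM; have [xs'|/ps px] := boolP (x \in s).
  by rewrite root_prod_XsubC xs' orbT.
by rewrite /root px eqxx.
Qed.

Lemma generic_affine {K : fieldType} (P : 'rV[K]_2 -> Prop) : generic P ->
  exists s : seq K, forall x, x \notin s -> P (row2 x 1).
Proof.
(* An excluded point at infinity has ratio 0 by the convention on division, which merely discards
   one more parameter. *)
case=> s Ps; exists [seq (y : 'rV_2) 0 0 / y 0 1 | y <- s] => x xs.
apply: Ps => [|y ys]; first by rewrite row2_neq0 !row2E oner_eq0 orbT.
apply: contra xs => /eq_rowsP[a a0 e]; apply/mapP; exists y => //.
have /rowP/(_ 0) := e; have /rowP/(_ 1) := e; rewrite !mxE /= => e1 ->.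
have y1 : y 0 1 != 0.
  by apply: contra_eq_neq e1 => ->; rewrite mulr0 oner_eq0.
by apply: (mulIf y1); rewrite divfK // mulrAC -e1 mul1r.
Qed.

Section Curves.
Context {K : fieldType} {m : nat}.
Implicit Types (Phi : 'M[K]_(m.+1, tdim m)) (F : 'I_m.+1 -> {poly K}).
Implicit Types (l : 'rV[K]_2).

(** Coprimality is stated as a Bezout identity, which a field morphism visibly preserves. *)
Definition basepoint_free e F :=
  [/\ forall p, (size (F p) <= e.+1)%N, exists p, (F p)`_e != 0
    & exists u, \sum_p u p * F p = 1].

Lemma regular_basepoint_free e F : regular_curve e F -> basepoint_free e F.
Proof.
case=> sF tF gF; split=> //; move: gF.
have [u] : exists u, \sum_p u p * F p %=
    foldr (@gcdp K) 0 [seq F i | i <- enum 'I_m.+1].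
  elim: (enum _) => [|a s [u IH]] /=.
    by exists (fun=> 0); rewrite big1 ?eqpxx // => p _; rewrite mul0r.
  set d := foldr _ _ _ in IH *.
  have [[v w] /= vw] := Bezoutp (F a) d.
  have /eqpP[[c1 c2] /= /andP[c10 c20] ce] := IH.
  exists (fun p => (p == a)%:R * v + (w * (c1 / c2)%:P) * u p).
  under eq_bigr do rewrite mulrDl -[_ * u _ * _]mulrA -[_ * v * _]mulrA.
  rewrite big_split -mulr_sumr /= (bigD1 a) //= eqxx mul1r big1 ?addr0; last first.
    by move=> p /negPf ->; rewrite mul0r.
  rewrite -mulrA; set S := \sum_p _ in ce *.
  suff -> : (c1 / c2)%:P * S = d by [].
  by rewrite mul_polyC mulrC -scalerA ce scalerA mulVf // scale1r.
move=> + /eqP/size_poly1P[c c0 dc]; rewrite dc => /eqpP[[a b] /= /andP[a0 b0] ab].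
exists (fun p => (a / (b * c))%:P * u p).
under eq_bigr do rewrite -mulrA.
rewrite -mulr_sumr mul_polyC; have -> : a / (b * c) = (b * c)^-1 * a by rewrite mulrC.
rewrite -scalerA ab -mul_polyC -mul_polyC -!polyCM.
by have -> : (b * c)^-1 * (b * c) = 1 by rewrite mulVf // mulf_neq0.
Qed.

Lemma form_evalE e F l p : form_eval e F l 0 p = heval e (F p) l.
Proof. by rewrite mxE. Qed.

(** At infinity a nonzero top coefficient survives; elsewhere the Bezout identity rules out a common
    root. *)
Lemma form_eval_neq0 e F l : basepoint_free e F -> l != 0 -> form_eval e F l != 0.
Proof.
case=> sF [p Fp] [u uF]; rewrite row2_neq0; have [l1|l1] := eqVneq (l 0 1) 0.
  rewrite orbF => l0; apply: contra_neq Fp => /rowP/(_ p)/eqP.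
  by rewrite form_evalE heval_infty // mxE mulf_eq0 expf_eq0 (negPf l0) andbF orbF => /eqP.
move=> _; apply/eqP => h; have /eqP := congr1 (horner^~ (l 0 0 / l 0 1)) uF.
rewrite hornerC horner_sum big1 ?(eq_sym 0) ?oner_eq0 // => q _.
move/rowP/(_ q)/eqP: h; rewrite form_evalE heval_affine // mxE mulf_eq0.
by rewrite expf_eq0 (negPf l1) andbF /= hornerM => /eqP ->; rewrite mulr0.
Qed.

Lemma form_eval_scale e F c l : form_eval e F (c *: l) = c ^+ e *: form_eval e F l.
Proof. by apply/rowP => p; rewrite [RHS]mxE !form_evalE heval_scale. Qed.

(** The Bezout identities make each tuple a polynomial multiple of the other, so the factor is a
    unit. The nonzero top coefficients then force equal degrees. *)
Lemma curve_unique e e' F F' : basepoint_free e F -> basepoint_free e' F' ->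
  (forall p q, F p * F' q = F q * F' p) ->
  e = e' /\ exists2 c, c != 0 & forall p, F' p = c *: F p.
Proof.
move=> [sF [p0 tF] [u uF]] [sF' [q0 tF'] [u' uF']] FF'.
pose c := \sum_p u p * F' p; pose c' := \sum_p u' p * F p.
have F'c p : F' p = c * F p.
  rewrite -[LHS]mul1r -uF /c !mulr_suml; apply: eq_bigr => q _.
  by rewrite -!mulrA FF' (mulrC (F' q)) FF'.
have cc : c * c' = 1.
  by rewrite -uF' /c' mulr_sumr; apply: eq_bigr => p _; rewrite F'c; ring.
have /size_poly1P[a a0 ca] : size c == 1%N by rewrite -dvdp1 -cc dvdp_mulr.
have {}F'c p : F' p = a *: F p by rewrite F'c ca mul_polyC.
split; last by exists a.
have lt_size (p : {poly K}) n : p`_n != 0 -> (n < size p)%N.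
  by apply: contraNT; rewrite -leqNgt => h; rewrite nth_default.
have tF1 : (F q0)`_e' != 0.
  by move: tF'; rewrite F'c coefZ mulf_eq0 negb_or => /andP[].
have tF2 : (F' p0)`_e != 0 by rewrite F'c coefZ mulf_neq0.
apply/anti_leq/andP; split; rewrite -ltnS.
  exact: leq_trans (lt_size _ _ tF2) (sF' p0).
exact: leq_trans (lt_size _ _ tF1) (sF q0).
Qed.

End Curves.

(** * Base change *)

Section CurveTensor.
Context {K : fieldType} {m : nat}.
Implicit Types (Phi : 'M[K]_(m.+1, tdim m)) (F : 'I_m.+1 -> {poly K}).
Implicit Types (l : 'rV[K]_2) (j : 'I_m).

Definition tens Phi F (i : idx m) : {poly K} :=
  \sum_p Phi p (enum_rank i) *: F p.

Lemma size_tens e Phi F i : (forall p, (size (F p) <= e.+1)%N) ->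
  (size (tens Phi F i) <= e.+1)%N.
Proof.
move=> sF; apply: leq_trans (size_sum _ _ _) _; apply/bigmax_leqP => p _.
exact: leq_trans (size_scale_leq _ _) (sF p).
Qed.

Lemma tcoord_curve e Phi F l i :
  tcoord (form_eval e F l *m Phi) i = heval e (tens Phi F i) l.
Proof.
rewrite /tcoord mxE heval_sum; apply: eq_bigr => p _.
by rewrite hevalZ form_evalE mulrC.
Qed.

Lemma contr_scale c (v : 'rV[K]_(tdim m)) j l :
  contr (tcoord v) j l -> contr (tcoord (c *: v)) j l.
Proof.
by move=> vl i; rewrite /tcoord !mxE -(mulr0 c) -(vl i); rewrite /tcoord; ring.
Qed.

Lemma tcoord_neq0 (v : 'rV[K]_(tdim m)) : v != 0 -> exists i, tcoord v i != 0.
Proof.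
move=> v0; apply/existsP; apply: contra_neqT v0 => /existsPn h.
apply/rowP => t; rewrite -(enum_valK t) [RHS]mxE.
exact/eqP/negPn/h.
Qed.

Lemma mulmx_neq0 Phi (v : 'rV[K]_m.+1) : row_free Phi -> v != 0 -> v *m Phi != 0.
Proof. by move=> rPhi; apply: contra_neq => h; apply: (row_free_inj rPhi); rewrite h mul0mx. Qed.

(* [psi] satisfies the defining incidence [psi l <= Sigma0 j l] as a polynomial identity *)
Definition slot_curve Phi j F := forall i,
  'X * tens Phi F (upd i j 0) + tens Phi F (upd i j 1) = 0.

Lemma slot_curve_contr e Phi j F : (forall p, (size (F p) <= e.+1)%N) ->
  slot_curve Phi j F -> forall l, contr (tcoord (form_eval e F l *m Phi)) j l.
Proof.
move=> sF Tj l i; rewrite !tcoord_curve.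
have sT i' := size_tens e Phi F i' sF.
have := congr1 (fun p => heval e.+1 p l) (Tj i).
(* The second term is multiplied by 1, read as a form of degree 1: it evaluates to [l 0 1], just as
   ['X] evaluates to [l 0 0]. *)
rewrite /= heval0 hevalD -[in heval _ (tens _ _ (upd i j 1)) _](mul1r (tens _ _ (upd i j 1))).
rewrite -add1n !hevalM ?size_polyX ?size_poly1 // !heval_lin !coefX !coef1 /=.
by rewrite mul0r !mul1r mul0r addr0 add0r.
Qed.

End CurveTensor.

Lemma fcurve_slot_curve {K : numFieldType} {m : nat}
    (Phi : 'M[K]_(m.+1, tdim m)) j e F : fcurve Phi j e F -> slot_curve Phi j F.
Proof.
case=> /regular_basepoint_free[sF _ _] /generic_affine[s Fs] i.
apply: (@poly_eq0_cofinite _ _ s) => x /Fs[_ /andP[]].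
rewrite sub_capmx => /andP[_ /Sigma0P/(_ i)] + _.
by rewrite !tcoord_curve !row2E !heval_x1 ?size_tens // !hornerE.
Qed.

Lemma fcurve_basepoint_free {K : fieldType} {m : nat}
    (Phi : 'M[K]_(m.+1, tdim m)) j e F : fcurve Phi j e F -> basepoint_free e F.
Proof. by case=> /regular_basepoint_free. Qed.

Section BaseChange.
Context {K L : fieldType} (f : {rmorphism K -> L}) {m : nat}.
Implicit Types (Phi : 'M[K]_(m.+1, tdim m)) (F : 'I_m.+1 -> {poly K}).

Definition map_curve F p := map_poly f (F p).

Lemma basepoint_free_map e F : basepoint_free e F -> basepoint_free e (map_curve F).
Proof.
case=> sF [p0 Fp] [u uF]; split=> [p||].
- by rewrite size_map_poly.
- by exists p0; rewrite coef_map fmorph_eq0.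
exists (fun p => map_poly f (u p)); rewrite -(rmorph1 (map_poly f)) -uF rmorph_sum.
by apply: eq_bigr => p _; rewrite rmorphM.
Qed.

Lemma form_eval_map e F l :
  form_eval e (map_curve F) (map_mx f l) = map_mx f (form_eval e F l).
Proof. by apply/rowP => p; rewrite [RHS]mxE !form_evalE heval_map. Qed.

Lemma tens_map Phi F i :
  tens (map_mx f Phi) (map_curve F) i = map_poly f (tens Phi F i).
Proof. by rewrite /tens rmorph_sum; apply: eq_bigr => p _; rewrite mxE /= map_polyZ. Qed.

Lemma slot_curve_map Phi j F : slot_curve Phi j F ->
  slot_curve (map_mx f Phi) j (map_curve F).
Proof.
by move=> Tj i; rewrite !tens_map -(map_polyX f) -rmorphM -rmorphD Tj rmorph0.
Qed.

End BaseChange.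

(** At a generic parameter the curve over [L] spans the whole intersection with [Sigma0]. The
    extended curve satisfies the same incidence, so the two are proportional there; their minors
    vanish identically and [curve_unique] applies. *)
Lemma fcurve_base_change {K L : numFieldType} (f : {rmorphism K -> L}) {m : nat}
    (Phi : 'M[K]_(m.+1, tdim m)) j e e' F F' : row_free Phi ->
  fcurve Phi j e F -> fcurve (map_mx f Phi) j e' F' ->
  e' = e /\ exists2 c, c != 0 & forall p, F' p = c *: map_curve f F p.
Proof.
move=> rPhi FP F'P; have bF := fcurve_basepoint_free _ _ _ _ FP.
have bF' := fcurve_basepoint_free _ _ _ _ F'P.
have bFf := basepoint_free_map f e F bF.
have sFf := slot_curve_map f _ _ _ (fcurve_slot_curve _ _ _ _ FP).
suff FF' p q : map_curve f F p * F' q = map_curve f F q * F' p.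
  by have [/esym] := curve_unique e e' (map_curve f F) F' bFf bF' FF'.
case: F'P => _ /generic_affine[s F's]; apply/eqP; rewrite -subr_eq0; apply/eqP.
apply: (@poly_eq0_cofinite _ _ s) => x /F's[_ /andP[_ h]].
have : (form_eval e (map_curve f F) (row2 x 1) *m map_mx f Phi <=
        form_eval e' F' (row2 x 1) *m map_mx f Phi)%MS.
  apply: submx_trans h; rewrite sub_capmx submxMl; apply/Sigma0P.
  by apply: slot_curve_contr => //; case: bFf.
case/sub_rVP => a; rewrite scalemxAl => /row_free_inj.
rewrite row_free_map => /(_ rPhi)/rowP e_a.
have {e_a} ea r : (map_curve f F r).[x] = a * (F' r).[x].
  case: bFf bF' => sF _ _ [sF' _ _].
  by have := e_a r; rewrite [RHS]mxE !form_evalE !heval_x1.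
by rewrite !hornerE !ea; ring.
Qed.

(** One half of [same_image]; the two inclusions are descended and used separately. *)
Definition covered {K : fieldType} {m : nat} e1 e2 (F1 F2 : 'I_m.+1 -> {poly K}) :=
  forall l, l != 0 ->
    exists2 l', l' != 0 & (form_eval e1 F1 l == form_eval e2 F2 l')%MS.

(* The parameter on the second curve is recovered as the kernel of a
   contraction of a tensor over [K], hence is itself defined over [K]. *)
Lemma covered_descent {K L : fieldType} (f : {rmorphism K -> L}) {m : nat}
    (Phi : 'M[K]_(m.+1, tdim m)) e1 e2 F1 F2 (q : 'I_m) : row_free Phi ->
  basepoint_free e1 F1 -> basepoint_free e2 F2 -> slot_curve Phi q F2 ->
  covered e1 e2 (map_curve f F1) (map_curve f F2) -> covered e1 e2 F1 F2.
Proof.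
move=> rPhi b1 b2 s2 cov l l0.
have [|l' l'0 /eq_rowsP[a a0 e]] := cov (map_mx f l); first by rewrite map_mx_eq0.
set v := form_eval e1 F1 l; rewrite form_eval_map -/v in e.
have v0 : v != 0 by apply: form_eval_neq0.
have [i Ti] := tcoord_neq0 _ (mulmx_neq0 _ _ rPhi v0).
have fT i' : tcoord (map_mx f v *m map_mx f Phi) i' = f (tcoord (v *m Phi) i').
  by rewrite -map_mxM /tcoord mxE.
have cl' : contr (tcoord (map_mx f v *m map_mx f Phi)) q l'.
  rewrite e -scalemxAl; apply: contr_scale; apply: slot_curve_contr.
    by case: (basepoint_free_map f e2 F2 b2).
  exact: slot_curve_map.
have [|c lc] := contr_slot _ q i l' _ cl'; first by rewrite fT fmorph_eq0.
pose t := perp (slot (tcoord (v *m Phi)) q i).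
have {}lc : l' = c *: map_mx f t.
  by rewrite lc /t /perp /slot !row2_map !row2E !fT rmorphN.
have /andP[c0 t0] : (c != 0) && (t != 0).
  by move: l'0; rewrite lc scaler_eq0 negb_or map_mx_eq0.
exists t => //; rewrite -(map_submx f) -[X in _ && X](map_submx f).
apply/eq_rowsP; exists (a * c ^+ e2); first by rewrite mulf_neq0 ?expf_neq0.
by rewrite e lc form_eval_scale form_eval_map scalerA.
Qed.

(** * Factoring polynomial tensors *)

(** The slots of [A] are changed one at a time; [w s] is [i] with the slots in [s] already replaced
    by those of [i']. *)
Lemma eq_off_slots {m : nat} {X : Type} (A : {set 'I_m}) (b : idx m -> X) :
  (forall q i k, q \in A -> b (upd i q k) = b i) ->
  forall i i' : idx m, (forall r, r \notin A -> i r = i' r) -> b i = b i'.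
Proof.
move=> bA i i' ii'.
pose w (s : seq 'I_m) : idx m := [ffun r : 'I_m => if r \in s then i' r else i r].
have ws s : {subset s <= A} -> b (w s) = b i.
  elim: s => [_|q s IH sA]; first by congr b; apply/ffunP => r; rewrite ffunE.
  rewrite -IH => [|r rs]; last by rewrite sA // inE rs orbT.
  rewrite -(bA q (w s) (i' q)) ?sA ?mem_head //; congr b.
  by apply/ffunP => r; rewrite !ffunE inE; case: (r =P q) => [->|].
rewrite -(ws (enum A)) => [|r]; last by rewrite mem_enum.
congr b; apply/ffunP => r; rewrite ffunE mem_enum.
by case: ifPn => // rA; rewrite ii'.
Qed.

Section RankOne.
Context {R : comNzRingType} {m : nat}.
Implicit Types (i : idx m).

(* Unimodularity of [a q] makes the contraction of slot [q] by [u q] an inverse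
   of the tensor product with [a q]. *)
Lemma rank_one_slots (s : seq 'I_m) (a u : 'I_m -> 'I_2 -> R) (T : idx m -> R) :
  uniq s ->
  (forall q, q \in s -> \sum_k u q k * a q k = 1) ->
  (forall q, q \in s -> forall i k, a q (i q) * T (upd i q k) = a q k * T i) ->
  exists b : idx m -> R,
    (forall i, T i = (\prod_(q <- s) a q (i q)) * b i) /\
    forall q, q \in s \/ (forall i k, T (upd i q k) = T i) ->
      forall i k, b (upd i q k) = b i.
Proof.
elim: s T => [|r s IH] T /=.
  by exists T; split=> [i|q []//]; rewrite big_nil mul1r.
case/andP=> rs us ua aT.
pose T1 i := \sum_k u r k * T (upd i r k).
have TT1 i : T i = a r (i r) * T1 i.
  rewrite -[LHS]mul1r -(ua r) ?mem_head // mulr_suml mulr_sumr.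
  by apply: eq_bigr => k _; rewrite -mulrA -aT ?mem_head //; ring.
have [|q qs i k|b [Tb bT]] := IH T1 us.
- by move=> q qs; apply: ua; rewrite inE qs orbT.
- have qr : q != r by apply: contraNneq rs => <-.
  rewrite /T1 !mulr_sumr; apply: eq_bigr => k' _.
  have := aT q _ (upd i r k') k; rewrite inE qs orbT => /(_ isT).
  rewrite upd_other // -updC // => h.
  by rewrite mulrCA h; ring.
exists b; split=> [i|q qT].
  by rewrite TT1 Tb big_cons mulrA.
(* The second alternative of the induction hypothesis keeps track of slot [r]: contracting it makes
   [T1] independent of that slot. *)
apply: bT; have [->|qr] := eqVneq q r.
  by right=> i k; rewrite /T1; under eq_bigr do rewrite upd_upd.
case: qT; first by rewrite inE (negPf qr); left.
move=> Tq; right=> i k; rewrite /T1; apply: eq_bigr => k' _.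
by rewrite updC // Tq.
Qed.

End RankOne.

Section PolyTensor.
Context {K : fieldType} {m : nat}.
Implicit Types (T : idx m -> {poly K}) (q : 'I_m) (i : idx m).

(** One nonzero slot vector divided by the gcd of its entries is unimodular, by Bezout. The
    vanishing minors make every other slot vector proportional to it, and the gcd cancels. *)
Lemma slot_factor T q i0 : T i0 != 0 ->
  (forall i i', T (upd i q 0) * T (upd i' q 1) = T (upd i q 1) * T (upd i' q 0)) ->
  exists au : ('I_2 -> {poly K}) * ('I_2 -> {poly K}),
    \sum_k au.2 k * au.1 k = 1 /\
    forall i k, au.1 (i q) * T (upd i q k) = au.1 k * T i.
Proof.
move=> Ti0 minors; pose t k := T (upd i0 q k); pose g := gcdp (t 0) (t 1).
have g0 : g != 0.
  rewrite gcdp_eq0; apply: contra_neqN Ti0 => /andP[/eqP t0 /eqP t1].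
  by rewrite -(upd_id i0 q); elim/forall_I2: (i0 q).
pose a k := t k %/ g.
have ta k : t k = a k * g.
  rewrite divpK //; elim/forall_I2: k; [exact: dvdp_gcdl | exact: dvdp_gcdr].
have [[u0 u1] /= e] := Bezoutp (t 0) (t 1); rewrite -/g in e.
have /eqpP[[c1 c2] /= /andP[c10 c20] ce] := e.
pose u (k : 'I_2) := (c2^-1 * c1) *: (if k == 0 then u0 else u1).
exists (a, u); split=> /= [|i k].
  apply: (mulIf g0); rewrite mul1r sum_I2 /u /= mulrDl -!scalerAl -!mulrA -!ta.
  by rewrite -scalerDr -scalerA ce scalerA mulVf // scale1r.
apply: (mulIf g0); rewrite mulrAC -ta mulrAC -ta /t.
have tt k1 k2 : T (upd i0 q k1) * T (upd i q k2) = T (upd i0 q k2) * T (upd i q k1).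
  elim/forall_I2: k1; elim/forall_I2: k2; rewrite ?minors // mulrC // -minors mulrC //.
by rewrite tt upd_id.
Qed.

Lemma size_prod_pred (I : finType) (P : pred I) (F : I -> {poly K}) :
  (forall x, P x -> F x != 0) ->
  size (\prod_(x | P x) F x) = (\sum_(x | P x) (size (F x)).-1).+1.
Proof.
move=> F0; rewrite size_prod //.
rewrite (eq_bigr (fun x => (size (F x)).-1 + 1)%N) => [|x Px]; last first.
  by rewrite addn1 prednK // size_poly_gt0 F0.
by rewrite big_split sum1_card -addSn addnK.
Qed.

Lemma degree_bound e (A : {set 'I_m}) (a : 'I_m -> 'I_2 -> {poly K}) T b :
  (forall i, T i = (\prod_(q in A) a q (i q)) * b i) ->
  (forall q i k, q \in A -> b (upd i q k) = b i) ->
  (forall i, (size (T i) <= e.+1)%N) ->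
  (exists i, b i != 0) ->
  (forall q, q \in A -> exists k, (1 < size (a q k))%N) ->
  (#|A| <= e)%N /\ (#|A| = e ->
    (forall q k, q \in A -> (size (a q k) <= 2)%N) /\
    (forall i, (size (b i) <= 1)%N)).
Proof.
move=> Tab bA sT [i0 bi0] sa.
pose kmax q : 'I_2 := [arg max_(k > 0) size (a q k)].
have kmaxP q k : (size (a q k) <= size (a q (kmax q)))%N.
  by rewrite /kmax; case: arg_maxnP => // k' _; apply.
pose im := [arg max_(i > i0) size (b i)].
have imP i : (size (b i) <= size (b im))%N.
  by rewrite /im; case: arg_maxnP => // k' _; apply.
(* Since [b] ignores the slots in [A], one multi-index can maximise the degrees of all the factors
   at once. *)
pose i : idx m := [ffun r => if r \in A then kmax r else im r].
have bi : b i = b im.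
  by apply: (eq_off_slots A) => // r rA; rewrite ffunE (negPf rA).
have b0 : (0 < size (b im))%N by apply: leq_trans (imP i0); rewrite size_poly_gt0.
pose d q := (size (a q (kmax q))).-1.
have d1 q : q \in A -> (0 < d q)%N.
  by case/sa=> k ak; rewrite -ltnS prednK ?(leq_trans ak) // (leq_trans _ (kmaxP q k)) // ltnW.
have bound : (\sum_(q in A) d q + size (b im) <= e.+1)%N.
  apply: leq_trans (sT i); rewrite Tab bi.
  rewrite (eq_bigr (fun q => a q (kmax q))) => [|q qA]; last by rewrite ffunE qA.
  have a0 q : q \in A -> a q (kmax q) != 0.
    by move/d1; rewrite -size_poly_gt0 /d; case: (size _).
  rewrite size_mul ?size_prod_pred ?addSn //; last by rewrite -size_poly_gt0.
  by apply/prodf_neq0.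
have lowA (B : {set 'I_m}) : B \subset A -> (#|B| <= \sum_(q in B) d q)%N.
  by move=> BA; rewrite -sum1_card; apply: leq_sum => q qB; apply/d1/(subsetP BA).
have lA := lowA A (subxx A).
split; first by move: bound lA b0; lia.
move=> cA; split=> [q k qA|i']; last first.
  by apply: leq_trans (imP i') _; move: bound lA; rewrite cA; lia.
apply: leq_trans (kmaxP q k) _.
have dq : size (a q (kmax q)) = (d q).+1.
  by move: (d1 q qA); rewrite /d; case: (size _).
(* The other slots already use up degree at least [#|A| - 1], leaving at most 1 for slot [q]. *)
have := lowA (A :\ q) (subD1set A q); move: bound; rewrite (big_setD1 q) //= dq.
have := cardsD1 q A; rewrite qA cA add1n => -> h1 h2.
have arith (x y z c : nat) : (0 < z -> x + y + z <= c.+2 -> c <= y -> x.+1 <= 2)%N by lia.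
exact: arith b0 h1 h2.
Qed.

End PolyTensor.

(** * The class of a curve *)

Section Class.
Context {K : numFieldType} {m : nat} (Phi : 'M[K]_(m.+1, tdim m)).
Context (es : 'I_m -> nat) (Fs : 'I_m -> 'I_m.+1 -> {poly K}).
Hypothesis rPhi : row_free Phi.
Hypothesis bpf : forall q, basepoint_free (es q) (Fs q).
Hypothesis slotc : forall q, slot_curve Phi q (Fs q).
Implicit Types (i : idx m) (q j : 'I_m) (l : 'rV[K]_2).

Let psi q l := form_eval (es q) (Fs q) l.
Let ten q l := tcoord (psi q l *m Phi).
Let covers j q := covered (es j) (es q) (Fs j) (Fs q).

Lemma psi_neq0 q l : l != 0 -> psi q l != 0.
Proof. exact: form_eval_neq0. Qed.

Lemma ten_neq0 q l : l != 0 -> exists i, ten q l i != 0.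
Proof. by move=> l0; apply/tcoord_neq0/mulmx_neq0/psi_neq0. Qed.

Lemma contr_psi q l : contr (ten q l) q l.
Proof. by apply: slot_curve_contr => //; case: (bpf q). Qed.

Lemma ten_x1 q x i : ten q (row2 x 1) i = (tens Phi (Fs q) i).[x].
Proof.
by rewrite /ten tcoord_curve heval_x1 //; apply: size_tens; case: (bpf q).
Qed.

Lemma contr_eq_rows q j l l' : (psi j l == psi q l')%MS -> contr (ten j l) q l'.
Proof.
case/eq_rowsP => a a0 e; rewrite /ten e -scalemxAl.
exact/contr_scale/contr_psi.
Qed.

(** A nonzero tensor has at most a line of vectors contracting slot [q] to zero, and both parameters
    lie on it. *)
Lemma psi_inj q l l' : l != 0 -> l' != 0 -> (psi q l == psi q l')%MS ->
  exists c, l' = c *: l.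
Proof.
move=> l0 l'0 /contr_eq_rows cl'; have [i Ti] := ten_neq0 q l l0.
exact: contr_uniq Ti (contr_psi q l) cl' l0.
Qed.

(** Covering makes slot [q] of rank one at every parameter, so [slot_factor] applies. Were the
    factor constant, a fixed vector would contract slot [q] to zero everywhere, and all affine
    points of [psi j] would be the single point of [psi q] at that vector, against injectivity. *)
Lemma covers_factor j q : covers j q ->
  exists au : ('I_2 -> {poly K}) * ('I_2 -> {poly K}),
  [/\ \sum_k au.2 k * au.1 k = 1,
      forall i k, au.1 (i q) * tens Phi (Fs j) (upd i q k) = au.1 k * tens Phi (Fs j) i
    & exists k, (1 < size (au.1 k))%N].
Proof.
move=> cov; set T := tens Phi (Fs j).
have x1 x : row2 x 1 != 0 :> 'rV[K]_2 by rewrite row2_neq0 !row2E oner_eq0 orbT.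
have [i0 Ti0] : exists i, T i != 0.
  have [t] := ten_neq0 j _ (x1 0); rewrite ten_x1 => h; exists t.
  by apply: contra_neq h; rewrite /T => ->; rewrite horner0.
have minors i i' : T (upd i q 0) * T (upd i' q 1) = T (upd i q 1) * T (upd i' q 0).
  apply/eqP; rewrite -subr_eq0; apply/eqP; apply: (@poly_eq0_cofinite _ _ [::]) => x _.
  have [l' l'0 /contr_eq_rows/contr_minors/(_ l'0 i i')] := cov _ (x1 x).
  by rewrite !ten_x1 !hornerE => ->; rewrite subrr.
have [[a u] /= [ua aT]] := slot_factor T q i0 Ti0 minors.
exists (a, u); split=> //=; apply/not_existsP => sa.
have {}sa k : (size (a k) <= 1)%N by rewrite leqNgt; apply/negP/sa.
pose l0 := perp (row2 (a 0)`_0 (a 1)`_0).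
have ax k x : (a k).[x] = (a k)`_0 by rewrite (size1_polyC (sa k)) hornerC coefC.
have cl0 x : contr (ten j (row2 x 1)) q l0.
  move=> i; rewrite !ten_x1 /l0 /perp !row2E.
  have := congr1 (horner^~ x) (aT (upd i q 0) 1).
  by rewrite upd_same upd_upd /= !hornerM !ax mulNr => ->; rewrite subrr.
have psi0 x : (psi j (row2 x 1) == psi q l0)%MS.
  have [l' l'0 /[dup] e /contr_eq_rows cl'] := cov _ (x1 x).
  have [i Ti] := ten_neq0 j _ (x1 x).
  have [c lc] := contr_uniq _ q i l' l0 Ti cl' (cl0 x) l'0.
  (* Otherwise [l0], hence the constant vector [a], would vanish, contradicting its
     unimodularity. *)
  have c0 : c != 0.
    apply: contra_eq_neq ua => c0; move: lc; rewrite c0 scale0r => /rowP lc.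
    have := lc 0; have := lc 1; rewrite !mxE /= => /eqP; rewrite oppr_eq0 => /eqP a0 a1.
    rewrite sum_I2 (size1_polyC (sa 0)) (size1_polyC (sa 1)) a0 a1.
    by rewrite !mulr0 addr0 eq_sym oner_eq0.
  have /eq_rowsP[d d0 ed] := e; apply/eq_rowsP; exists (d / c ^+ es q).
    by rewrite mulf_neq0 ?invr_neq0 ?expf_neq0.
  by rewrite /psi ed lc form_eval_scale scalerA divfK // expf_neq0.
have /eq_rowsP[c c0 e0] := psi0 0; have /eq_rowsP[d d0 e1] := psi0 1.
have [|a' /rowP e] := psi_inj j _ _ (x1 0) (x1 1).
  apply/eq_rowsP; exists (c / d); first by rewrite mulf_neq0 ?invr_neq0.
  by rewrite e0 e1 scalerA divfK.
by have := e 0; rewrite !mxE /= mulr0 => /eqP; rewrite oner_eq0.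
Qed.

Lemma class_factor j (A : {set 'I_m}) : (forall q, q \in A -> covers j q) ->
  exists (a : 'I_m -> 'I_2 -> {poly K}) (b : idx m -> {poly K}),
  [/\ forall i, tens Phi (Fs j) i = (\prod_(q in A) a q (i q)) * b i,
      forall q i k, q \in A -> b (upd i q k) = b i,
      exists i, b i != 0
    & forall q, q \in A -> exists k, (1 < size (a q k))%N].
Proof.
move=> Aj.
have /choice[au auP] q : exists au : ('I_2 -> {poly K}) * ('I_2 -> {poly K}),
    q \in A -> [/\ \sum_k au.2 k * au.1 k = 1,
      forall i k, au.1 (i q) * tens Phi (Fs j) (upd i q k) = au.1 k * tens Phi (Fs j) i
    & exists k, (1 < size (au.1 k))%N].
  have [qA|qA] := boolP (q \in A).
    by have [au h] := covers_factor j q (Aj q qA); exists au.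
  by exists (fun=> 0, fun=> 0).
have [||b [Tb bT]] := rank_one_slots (enum A) (fun q => (au q).1)
    (fun q => (au q).2) (tens Phi (Fs j)) (enum_uniq _).
- by move=> q; rewrite mem_enum => /auP[].
- by move=> q; rewrite mem_enum => /auP[].
exists (fun q => (au q).1), b; split=> [i|q i k qA||q /auP[]//].
- by rewrite Tb big_enum.
- by apply: bT; left; rewrite mem_enum.
have [|i] := ten_neq0 j (row2 0 1); first by rewrite row2_neq0 !row2E oner_eq0 orbT.
rewrite ten_x1 => h; exists i; apply: contra_neq h => bi.
by rewrite Tb bi mulr0 horner0.
Qed.

Lemma class_card j (A : {set 'I_m}) : (forall q, q \in A -> covers j q) ->
  (#|A| <= es j)%N.
Proof.
case/class_factor => a [b [Tab bA b0 sa]].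
have [|//] := degree_bound (es j) A a _ b Tab bA _ b0 sa.
by move=> i; apply: size_tens; case: (bpf j).
Qed.

(** Equality in the degree bound leaves linear factors and a constant remainder. A kernel vector of
    some [B q] would be a parameter where the curve tensor vanishes, so [B q] is invertible. *)
Lemma class_linear j (A : {set 'I_m}) : (forall q, q \in A -> covers j q) ->
  #|A| = es j ->
  exists (B : 'I_m -> 'M[K]_2) (g : idx m -> K),
  [/\ forall q, q \in A -> B q \in unitmx,
      forall q i k, q \in A -> g (upd i q k) = g i,
      exists i, g i != 0
    & forall l i, ten j l i = (\prod_(q in A) (l *m B q) 0 (i q)) * g i].
Proof.
move=> /class_factor[a [b [Tab bA [i0 b0] sa]]] cA.
have [||_ /(_ cA)[sa2 sb]] := degree_bound (es j) A a _ b Tab bA _ _ sa.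
- by move=> i; apply: size_tens; case: (bpf j).
- by exists i0.
(* Row 0 holds the coefficient of degree 1, because [heval] substitutes [l 0 0] for the variable. *)
pose B q : 'M[K]_2 := \matrix_(r, k) (a q k)`_(if r == 0 then 1 else 0).
have aB q k l : heval 1 (a q k) l = (l *m B q) 0 k.
  by rewrite heval_lin mxE sum_I2 !mxE /=; ring.
pose g i := (b i)`_0.
have TB l i : ten j l i = (\prod_(q in A) (l *m B q) 0 (i q)) * g i.
  rewrite /ten tcoord_curve Tab -cA -[X in heval X]addn0.
  have [|sA hA] := heval_prod _ A (fun q => a q (i q)) l.
    by move=> q qA; apply: sa2.
  by rewrite hevalM // heval_const hA; congr (_ * _); apply: eq_bigr => q _.
exists B, g; split=> // [q qA|q i k qA|].
- rewrite unitmxE unitfE; apply/negP => /det0P[l l0 lB].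
  have [t] := ten_neq0 j l l0; rewrite TB (bigD1 q) //= lB mxE.
  by rewrite !mul0r eqxx.
- by rewrite /g bA.
exists i0; rewrite /g; apply: contra_neq b0 => b00.
by rewrite (size1_polyC (sb i0)) b00.
Qed.

End Class.

(** * Linear reparametrisations and extension of scalars *)

Section Perp.
Context {K : fieldType}.
Implicit Types (l : 'rV[K]_2).

Definition perp_mx : 'M[K]_2 :=
  \matrix_(r, k) (if r == k then 0 else if r == 0 then - 1 else 1).

Lemma perpE l : perp l = l *m perp_mx.
Proof.
by apply: row2P; rewrite !row2E !mxE sum_I2 !mxE /= ?mulr0 ?add0r ?addr0 ?mulr1 ?mulrN1.
Qed.

Lemma perp_mx_unit : perp_mx \in unitmx.
Proof.
apply: (mulmx1_unit (B := - perp_mx) _).1; apply/matrixP => r k.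
rewrite !mxE sum_I2 !mxE; elim/forall_I2: r; elim/forall_I2: k => /=;
  by rewrite ?mul0r ?oppr0 ?mulr0 ?addr0 ?add0r ?mulN1r ?mul1r ?opprK.
Qed.

End Perp.

Section Reparametrisation.
Context {K L : numFieldType} (f : {rmorphism K -> L}) {m : nat}.

(** The form of degree [e] attached to [p], with polynomials substituted for both variables. *)
Definition hcomp (e : nat) (p A0 A1 : {poly K}) : {poly K} :=
  \sum_(k < e.+1) p`_k *: (A0 ^+ k * A1 ^+ (e - k)).

(** The morphism is left arbitrary so that the identity serves over [K] and [f] serves over [L]. *)
Lemma heval_hcomp (M : fieldType) (h : {rmorphism K -> M}) e p A0 A1 x :
  (map_poly h (hcomp e p A0 A1)).[x] =
  heval e (map_poly h p) (row2 (map_poly h A0).[x] (map_poly h A1).[x]).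
Proof.
rewrite /hcomp rmorph_sum horner_sum; apply: eq_bigr => k _.
by rewrite /= !row2E map_polyZ hornerZ rmorphM !rmorphXn hornerM !horner_exp coef_map mulrA.
Qed.

(** Proportionality at all affine points of [K] amounts to the vanishing of polynomial minors, and
    [f] carries these identities to [L]. The point at infinity is defined over [K], so the
    hypothesis there is transported directly. *)
Lemma linear_reparam_map e1 e2 (F1 F2 : 'I_m.+1 -> {poly K}) (M : 'M[K]_2) :
  basepoint_free e1 F1 -> basepoint_free e2 F2 -> M \in unitmx ->
  (forall l, l != 0 -> (form_eval e1 F1 l == form_eval e2 F2 (l *m M))%MS) ->
  forall l, l != 0 -> (form_eval e1 (map_curve f F1) l ==
                       form_eval e2 (map_curve f F2) (l *m map_mx f M))%MS.
Proof.
move=> b1 b2 Mu FM.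
pose A k : {poly K} := M 0 k *: 'X + (M 1 k)%:P.
have mapA (N : fieldType) (h : {rmorphism K -> N}) x :
    row2 x 1 *m map_mx h M = row2 (map_poly h (A 0)).[x] (map_poly h (A 1)).[x].
  apply: row2P; rewrite mxE sum_I2 !mxE /= rmorphD /= map_polyZ map_polyX map_polyC;
  by rewrite !hornerE mulrC.
pose P p := hcomp e2 (F2 p) (A 0) (A 1).
have PF p q : F1 p * P q = F1 q * P p.
  apply/eqP; rewrite -subr_eq0; apply/eqP; apply: (@poly_eq0_cofinite _ _ [::]) => x _.
  have [|a a0 /rowP e] := (eq_rowsP _ _).1 (FM (row2 x 1) _).
    by rewrite row2_neq0 !row2E oner_eq0 orbT.
  have {}e r : (F1 r).[x] = a * (P r).[x].
    have := e r; rewrite [RHS]mxE !form_evalE heval_x1; last by case: b1.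
    move=> ->; congr (_ * _); have := heval_hcomp _ idfun e2 (F2 r) (A 0) (A 1) x.
    by rewrite -mapA !map_poly_id // map_mx_id // => ->.
  by rewrite !hornerE !e; ring.
have b1' := basepoint_free_map f e1 F1 b1; have b2' := basepoint_free_map f e2 F2 b2.
have Mf : map_mx f M \in unitmx by rewrite map_unitmx.
have affine x : (form_eval e1 (map_curve f F1) (row2 x 1) ==
    form_eval e2 (map_curve f F2) (row2 x 1 *m map_mx f M))%MS.
  have x0 : row2 x 1 != 0 :> 'rV[L]_2 by rewrite row2_neq0 !row2E oner_eq0 orbT.
  apply: eq_rows_minors; [exact: form_eval_neq0 | apply: form_eval_neq0 => // | ].
    by apply: contra_neq x0 => h; rewrite -(mulmxK Mf (row2 x 1)) h mul0mx.
  move=> p q; rewrite !form_evalE mapA -!heval_hcomp !heval_x1 -?hornerM.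
  - by rewrite -!rmorphM PF.
  - by case: b1'.
  - by case: b1'.
have scale_l l c : c != 0 -> (form_eval e1 (map_curve f F1) l ==
      form_eval e2 (map_curve f F2) (l *m map_mx f M))%MS ->
    (form_eval e1 (map_curve f F1) (c *: l) ==
      form_eval e2 (map_curve f F2) ((c *: l) *m map_mx f M))%MS.
  move=> c0 /eq_rowsP[a a0 e]; apply/eq_rowsP; exists (c ^+ e1 * a / c ^+ e2).
    by rewrite !mulf_neq0 ?invr_neq0 ?expf_neq0.
  by rewrite -scalemxAl !form_eval_scale e !scalerA divfK // expf_neq0.
move=> l; rewrite row2_neq0; have [l1|l1 _] := eqVneq (l 0 1) 0.
  rewrite orbF => l0; have -> : l = l 0 0 *: map_mx f (row2 1 0).
    by rewrite row2_map rmorph1 rmorph0; apply: row2P; rewrite !mxE /= ?mulr1 ?l1 ?mulr0.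
  apply: scale_l => //; rewrite -map_mxM !form_eval_map.
  have /andP[h1 h2] : (form_eval e1 F1 (row2 1 0) == form_eval e2 F2 (row2 1 0 *m M))%MS.
    by apply: FM; rewrite row2_neq0 !row2E oner_eq0.
  by apply/andP; rewrite !map_submx.
have -> : l = l 0 1 *: row2 (l 0 0 / l 0 1) 1.
  by apply: row2P; rewrite !mxE /=; field.
exact: scale_l.
Qed.

End Reparametrisation.

(** * Matching parameters and the spanning tensor *)

Lemma coveredZ {K : fieldType} {m : nat} e1 e2 (F1 F2 G1 G2 : 'I_m.+1 -> {poly K}) c1 c2 :
  c1 != 0 -> c2 != 0 -> (forall p, G1 p = c1 *: F1 p) -> (forall p, G2 p = c2 *: F2 p) ->
  covered e1 e2 F1 F2 <-> covered e1 e2 G1 G2.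
Proof.
move=> c10 c20 G1E G2E.
have evZ e c (F G : 'I_m.+1 -> {poly K}) l : (forall p, G p = c *: F p) ->
    form_eval e G l = c *: form_eval e F l.
  by move=> GE; apply/rowP => p; rewrite [RHS]mxE !form_evalE GE hevalZ.
have E l l' : (form_eval e1 F1 l == form_eval e2 F2 l')%MS <->
    (form_eval e1 G1 l == form_eval e2 G2 l')%MS.
  rewrite (evZ e1 _ _ _ l G1E) (evZ e2 _ _ _ l' G2E); split=> /eq_rowsP[a a0 e]; apply/eq_rowsP.
    exists (c1 * a / c2); first by rewrite !mulf_neq0 ?invr_neq0.
    by rewrite e !scalerA divfK.
  exists (c1^-1 * a * c2); first by rewrite !mulf_neq0 ?invr_neq0.
  by rewrite -!scalerA -e scalerA mulVf // scale1r.
by split=> cov l /cov[l' l'0 /E]; exists l'.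
Qed.

(** Slot [q] of the curve tensor is [l *m B q], which [perp (l *m B q)] contracts to zero. So does
    the matching parameter given by the covering, and such vectors form a line. *)
Lemma class_reparam {K : numFieldType} {m : nat} (Phi : 'M[K]_(m.+1, tdim m))
    (es : 'I_m -> nat) (Fs : 'I_m -> 'I_m.+1 -> {poly K}) (j q : 'I_m)
    (A : {set 'I_m}) (B : 'I_m -> 'M[K]_2) (g : idx m -> K) : row_free Phi ->
  (forall q, basepoint_free (es q) (Fs q)) ->
  (forall q, slot_curve Phi q (Fs q)) ->
  (forall l i, tcoord (form_eval (es j) (Fs j) l *m Phi) i =
     (\prod_(r in A) (l *m B r) 0 (i r)) * g i) ->
  (forall i k, g (upd i q k) = g i) ->
  q \in A -> B q \in unitmx -> covered (es j) (es q) (Fs j) (Fs q) ->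
  forall l, l != 0 ->
    (form_eval (es j) (Fs j) l == form_eval (es q) (Fs q) (l *m (B q *m perp_mx)))%MS.
Proof.
move=> rPhi bpf slotc TB gq qA Bu cov l l0; rewrite mulmxA -perpE.
set t := perp (l *m B q).
have t0 : t != 0.
  rewrite /t perpE -mulmxA; apply: contra_neq l0 => h.
  by rewrite -(mulmxK (_ : B q *m perp_mx \in unitmx) l) ?h ?mul0mx // unitmx_mul Bu perp_mx_unit.
have ct : contr (tcoord (form_eval (es j) (Fs j) l *m Phi)) q t.
  move=> i; rewrite !TB !gq !(bigD1 q qA) /= !upd_same /t !row2E.
  rewrite [X in _ + _ * (_ * X * _)](eq_bigr (fun r => (l *m B r) 0 (upd i q 0 r))); first by ring.
  by move=> r /andP[_ rq]; rewrite !upd_other.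
have [l' l'0 /[dup] e] := cov l l0.
move/(contr_eq_rows Phi es Fs bpf slotc) => cl'.
have [i Ti] := ten_neq0 Phi es Fs rPhi bpf j l l0.
have [c lc] := contr_uniq _ q i t l' Ti ct cl' t0.
have c0 : c != 0 by apply: contra_neq l'0 => c0; rewrite lc c0 scale0r.
have /eq_rowsP[a a0 ->] := e; apply/eq_rowsP; exists (a * c ^+ es q).
  by rewrite mulf_neq0 ?expf_neq0.
by rewrite lc form_eval_scale scalerA.
Qed.

(** The rows of [ann l] are multiples of [perp l], so [tensor_span] is a column of scalars times
    [v]. *)
Lemma tensor_span_perp {K : fieldType} {m : nat} (A : {set 'I_m})
    (B : 'I_m -> 'M[K]_2) (g : idx m -> K) (l : 'rV[K]_2) (v : 'rV[K]_(tdim m)) :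
  l != 0 -> (forall i : idx m, tcoord v i = (\prod_(r in A) (perp l *m B r) 0 (i r)) * g i) ->
  (v == tensor_span A (fun r => ann l *m B r) g)%MS.
Proof.
move=> l0 vE; have [c [[k0 ck0] cE]] := ann_perp l l0.
have spanE s t : tensor_span A (fun r => ann l *m B r) g s t =
    (\prod_(r in A) c (ival s r)) * v 0 t.
  have -> : v 0 t = tcoord v (ival t) by rewrite /tcoord /ival enum_valK.
  rewrite mxE vE mulrA -big_split; congr (_ * _); apply: eq_bigr => r _ /=.
  by rewrite !mxE mulr_sumr; apply: eq_bigr => k _; rewrite cE mulrA.
pose C : 'cV[K]_(tdim m) := \col_s \prod_(r in A) c (ival s r).
have -> : tensor_span A (fun r => ann l *m B r) g = C *m v.
  by apply/matrixP => s t; rewrite spanE !mxE big_ord1 !mxE.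
apply/andP; split; last exact: submxMl.
(* Choosing the nonzero row [k0] of [ann l] in every slot yields a row of the span that is a nonzero
   multiple of [v]. *)
pose s0 : 'I_(tdim m) := enum_rank ([ffun=> k0] : idx m).
have C0 : C s0 0 != 0.
  by rewrite mxE; apply/prodf_neq0 => r _; rewrite /ival enum_rankK ffunE.
have e : v = ((C s0 0)^-1 *: delta_mx 0 s0) *m (C *m v).
  have Cv : row s0 (C *m v) = C s0 0 *: v.
    by apply/rowP => t; rewrite [LHS]mxE [LHS]mxE big_ord1 [RHS]mxE.
  by rewrite -scalemxAl -rowE Cv scalerA mulVf // scale1r.
by rewrite {1}e submxMl.
Qed.

Theorem theorem2p15 (R : realType) (m : nat) (Phi : 'M[R]_(m.+1, tdim m))
    (es : 'I_m -> nat) (Fs : 'I_m -> 'I_m.+1 -> {poly R})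
    (esC : 'I_m -> nat) (FsC : 'I_m -> 'I_m.+1 -> {poly R[i]}) :
  facstr Phi ->
  (forall j, fcurve Phi j (es j) (Fs j)) ->
  (forall j, fcurve (map_mx (real_complex R) Phi) j (esC j) (FsC j)) ->
  forall j : 'I_m,
    (decomposable es Fs j <-> decomposable esC FsC j) /\
    (decomposable es Fs j ->
      exists S : {set 'I_m}, #|S| = es j /\
      exists gamma : idx m -> R, gamma_in S gamma /\
      exists G : 'I_m -> 'M[R]_2, (forall r, r \in S -> G r \in unitmx) /\
      forall l : 'rV[R]_2, l != 0 ->
        (form_eval (es j) (Fs j) l *m Phi
           == tensor_span S (fun r => ann l *m G r) gamma)%MS).
Proof.
move=> [rPhi _] FsP FsCP j.
pose f : {rmorphism R -> R[i]} := real_complex R.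
have bpf q := fcurve_basepoint_free _ _ _ _ (FsP q).
have slotc q := fcurve_slot_curve _ _ _ _ (FsP q).
have cplx q := fcurve_base_change f Phi q (es q) (esC q) (Fs q) (FsC q) rPhi (FsP q) (FsCP q).
have esE q : esC q = es q by case: (cplx q).
have coveredC p q : covered (esC p) (esC q) (FsC p) (FsC q) <->
    covered (es p) (es q) (map_curve f (Fs p)) (map_curve f (Fs q)).
  case: (cplx p) (cplx q) => [-> [c c0 cE]] [-> [d d0 dE]].
  by symmetry; apply: coveredZ cE dE.
have descent q : same_image (esC q) (esC j) (FsC q) (FsC j) ->
    same_image (es q) (es j) (Fs q) (Fs j).
  case=> /coveredC h1 /coveredC h2.
  split; [exact: covered_descent (slotc j) h1 | exact: covered_descent (slotc q) h2].
have classP (A : {set 'I_m}) :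
    (forall i, i \in A <-> same_image (es i) (es j) (Fs i) (Fs j)) ->
    forall q, q \in A -> covered (es j) (es q) (Fs j) (Fs q).
  by move=> AP q /AP[].
split; last first.
  case=> A [AP cA]; exists A; split=> //.
  have [B [g [Bu gA g0 TB]]] := class_linear Phi es Fs rPhi bpf slotc j A (classP A AP) cA.
  exists g; split; first by split=> //; apply: eq_off_slots.
  (* The description is in terms of the annihilator of [l], spanned by [perp l]; the inverse of
     [perp_mx] recovers [l] from it. *)
  exists (fun q => invmx perp_mx *m B q); split=> [q qA|l l0].
    by rewrite unitmx_mul unitmx_inv perp_mx_unit Bu.
  apply: tensor_span_perp => // i; rewrite TB; congr (_ * _); apply: eq_bigr => r _.
  by rewrite perpE mulmxA mulmxK // perp_mx_unit.
split=> -[A [AP cA]]; exists A; (split; last by rewrite ?esE // -esE).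
  move=> q; split=> [qA|/descent/AP//].
  have [B [g [Bu gA g0 TB]]] := class_linear Phi es Fs rPhi bpf slotc j A (classP A AP) cA.
  have Mu : B q *m perp_mx \in unitmx by rewrite unitmx_mul Bu ?perp_mx_unit.
  have jq := class_reparam Phi es Fs j q A B g rPhi bpf slotc TB
    (fun i k => gA q i k qA) qA (Bu q qA) (classP A AP q qA).
  have jqC := linear_reparam_map f _ _ _ _ _ (bpf j) (bpf q) Mu jq.
  have MC : map_mx f (B q *m perp_mx) \in unitmx by rewrite map_unitmx.
  have neq0 (N : 'M[R[i]]_2) l : N \in unitmx -> l != 0 -> l *m N != 0.
    by move=> Nu; apply: contra_neq => h; rewrite -(mulmxK Nu l) h mul0mx.
  (* The matrix is invertible, so the reparametrisation and its inverse give both inclusions of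
     images. *)
  split; apply/coveredC => l l0.
    exists (l *m invmx (map_mx f (B q *m perp_mx))); first by rewrite neq0 ?unitmx_inv.
    have := jqC (l *m invmx (map_mx f (B q *m perp_mx))).
    by rewrite mulmxKV // neq0 ?unitmx_inv // => /(_ isT) /andP[h1 h2]; apply/andP.
  by exists (l *m map_mx f (B q *m perp_mx)); [exact: neq0 | exact: jqC].
(* By descent the real class [A'] contains the complex class [A]. It has at most [es j] elements,
   which is the size of [A], so the two coincide. *)
pose A' := [set q | `[< same_image (es q) (es j) (Fs q) (Fs j) >]].
have A'P q : q \in A' <-> same_image (es q) (es j) (Fs q) (Fs j).
  by rewrite inE; split=> /asboolP.
have AA' : A \subset A' by apply/subsetP => q /AP/descent/A'P.
have leA' := class_card Phi es Fs rPhi bpf slotc j A' (classP A' A'P).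
suff -> : A = A' by [].
by apply/eqP; rewrite eqEcard AA' cA esE.
Qed.
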